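(* Let $n\ge 1$ and let $Y_1,\dots,Y_n$ be continua of surjective semispan $0$. Then the product $Y_1\times\cdots\times Y_n$ has the proximate fixed point property.
   Context: A compactum is a compact metric space; a continuum is a connected compactum; a mapping is a continuous function. A (not necessarily continuous) function $f:X\to Y$ between compacta is $\delta$-continuous if there is $\eta>0$ such that $\rho(x,x')<\eta$ implies $\rho(f(x),f(x'))<\delta$. A compactum $X$ has the proximate fixed point property if for every $\varepsilon>0$ there is $\delta>0$ such that for every $\delta$-continuous function $f:X\to X$ there is a point $x\in X$ with $\rho(x,f(x))\le\varepsilon$ (this is a topological property). A continuum $Y$ is of surjective semispan $0$ if for every continuum $K$ and every two mappings $f,g:K\to Y$ with $f$ surjective there exists $k\in K$ with $f(k)=g(k)$. *)

(* Defs.v *)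
From HB Require Import structures.
From mathcomp Require Import all_boot all_order all_algebra.
From mathcomp Require Import all_classical all_reals all_analysis.

Set Implicit Arguments.
Unset Strict Implicit.
Unset Printing Implicit Defensive.

Import Order.TTheory GRing.Theory Num.Theory.
Import numFieldNormedType.Exports.

Local Open Scope classical_set_scope.
Local Open Scope ring_scope.

(* Continua are nonempty, as is standard: this rules out the empty space,
   on which no map has a near-fixed point. *)
Definition continuum (R : realType) (X : metricType R) : Prop :=
  [/\ [set: X] !=set0, compact [set: X] & connected [set: X]].

(* This is not continuity: f is arbitrary, and d is fixed. *)
Definition delta_continuous (R : realType) (X Y : metricType R) (d : R)
    (f : X -> Y) : Prop :=
  exists2 eta : R, 0 < eta &
    forall x x' : X, mdist x x' < eta -> mdist (f x) (f x') < d.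

Definition proximate_fixed_point_property (R : realType) (X : metricType R)
    : Prop :=
  forall eps : R, 0 < eps ->
  exists2 d : R, 0 < d &
    forall f : X -> X, delta_continuous d f ->
    exists x : X, mdist x (f x) <= eps.

Definition surjective_semispan0 (R : realType) (Y : metricType R) : Prop :=
  forall K : metricType R, continuum K ->
  forall f g : K -> Y, continuous f -> continuous g ->
    set_surj [set: K] [set: Y] f ->
  exists k : K, f k = g k.

(* The product Y_0 x ... x Y_(n-1), an alias of the dependent function type
   that carries the maximum metric; max_prod_nbhsE below shows that this
   metric induces the product topology. *)
Definition max_prod (R : realType) (n : nat) (Y : 'I_n -> metricType R) : Type :=
  forall i, Y i.

Definition max_prod_dist (R : realType) (n : nat) (Y : 'I_n -> metricType R)
    (x y : max_prod Y) : R :=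
  \big[Num.max/0]_(i < n) mdist (x i) (y i).

Section max_prod_metric.
Variables (R : realType) (n : nat) (Y : 'I_n -> metricType R).
Implicit Types x y z : max_prod Y.

Lemma max_prod_dist_ge x y i : mdist (x i) (y i) <= max_prod_dist x y.
Proof. exact: (le_bigmax _ (fun j => mdist (x j) (y j))). Qed.

Lemma max_prod_dist_le x y (e : R) : 0 <= e ->
  (forall i, mdist (x i) (y i) <= e) -> max_prod_dist x y <= e.
Proof. by move=> e0 xye; apply: bigmax_le. Qed.

Lemma max_prod_dist_lt x y (e : R) : 0 < e ->
  (forall i, mdist (x i) (y i) < e) -> max_prod_dist x y < e.
Proof. by move=> e0 xye; apply: bigmax_lt. Qed.

Lemma max_prod_dist_ge0 x y : 0 <= max_prod_dist x y.
Proof. exact: bigmax_ge_id. Qed.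

Lemma max_prod_distxx x : max_prod_dist x x = 0.
Proof.
apply/eqP; rewrite eq_le max_prod_dist_ge0 andbT.
by apply: max_prod_dist_le => // i; rewrite mdistxx.
Qed.

Lemma max_prod_dist_positivity x y : max_prod_dist x y = 0 -> x = y.
Proof.
move=> xy0; apply: functional_extensionality_dep => i.
apply: mdist_positivity; apply/eqP.
by rewrite eq_le mdist_ge0 andbT -xy0 max_prod_dist_ge.
Qed.

Lemma max_prod_dist_sym x y : max_prod_dist x y = max_prod_dist y x.
Proof. by apply: eq_bigr => i _; rewrite metric_sym. Qed.

Lemma max_prod_dist_triangle y x z :
  max_prod_dist x z <= max_prod_dist x y + max_prod_dist y z.
Proof.
apply: max_prod_dist_le => [|i]; first by rewrite addr_ge0// max_prod_dist_ge0.
by rewrite (le_trans (metric_triangle _ (y i) _))// lerD// max_prod_dist_ge.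
Qed.

HB.instance Definition _ := gen_eqMixin (max_prod Y).
HB.instance Definition _ := gen_choiceMixin (max_prod Y).
HB.instance Definition _ := isMetric.Build R (max_prod Y)
  max_prod_distxx max_prod_dist_positivity max_prod_dist_sym
  max_prod_dist_triangle.

Lemma max_prod_mdistE x y :
  mdist x y = \big[Num.max/0]_(i < n) mdist (x i) (y i).
Proof. by []. Qed.

Lemma max_prod_nbhsE x : nbhs x = nbhs (x : prod_topology Y).
Proof.
apply/seteqP; split => A.
- rewrite -(@metricType_numDomainType.filter_from_mdist_nbhs R (max_prod Y)) => -[e /= e0 eA].
  have near_i (i : 'I_n) :
      nbhs (x : prod_topology Y) [set y : prod_topology Y | mdist (x i) (y i) < e].
    apply: (@proj_continuous _ Y i x [set z | mdist (x i) z < e]).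
    by rewrite -ballEmdist; exact: nbhsx_ballx.
  have Fx : Filter (nbhs (x : prod_topology Y)) by exact: nbhs_filter.
  apply: (@filterS _ _ Fx _ A _ (filter_forall Fx near_i)) => y xye.
  by apply: eA; exact: max_prod_dist_lt.
- have Fx : Filter (nbhs x) by exact: nbhs_filter.
  move: A; apply/(@cvg_sup _ _ _ _ _ Fx) => i B [C [[U oU <-] Ux] UB].
  apply: (filterS UB).
  have : nbhs (x i) U by apply: open_nbhs_nbhs; split.
  rewrite -(@metricType_numDomainType.filter_from_mdist_nbhs R (Y i)).
  move=> [e /= e0 eU].
  rewrite -(@metricType_numDomainType.filter_from_mdist_nbhs R (max_prod Y)).
  exists e => //= y xye; apply: eU.
  exact: le_lt_trans (max_prod_dist_ge _ _ _) xye.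
Qed.

End max_prod_metric.

(* Main.v *)
Require Import Defs.
From HB Require Import structures.
From mathcomp Require Import all_boot all_order all_algebra.
From mathcomp Require Import all_classical all_reals all_analysis.
From mathcomp Require Import zify ring lra.

(** Suppose that a function [f] on the product moves every point by more than
[eps], and that nearby points have [d]-close images for a tiny [d].  Inside
each continuum [Y i] there is a walk [phi i], a finite sequence of points with
tiny steps that comes close to every point of [Y i] ([dense_walk]).  The walks
together map a grid {0, ..., N}^n into the product.  At each grid point [a]
some coordinate is moved by more than [eps]; such a coordinate is chosen as the
colour of [a].  This turns the factors, which have no order or ends of their
own, into the sides of a cube, so that the [n]-dimensional Hex theorem ([hex])
applies: for some colour [i], a path of grid points of colour [i] joins the
face [a i = 0] to the face [a i = N].

Along that path, the pairs formed by the [i]-th coordinate of the point and the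
[i]-th coordinate of its image are a chain with small steps in the square of
[Y i].  The first entries of the pairs run through the whole walk [phi i], hence
are dense up to a small error, while the two entries of each pair are more than
[eps] apart.  If such chains existed with arbitrarily small steps, they would
accumulate on a continuum in the square ([limit_set_continuum]) which projects
onto the first factor and misses the diagonal, against surjective semispan 0
([semispan0_chain]).

The Hex theorem follows from the cubical form of Sperner's lemma
([kuhn_cube]), applied to a finer grid.  That lemma is a computation modulo 2.
For labels [g k] equal to 0 on one face of the cube and to 1 on the opposite
one, the cup product of the coboundaries of all the [g k] is a cocycle on unit
cubes, and Stokes' theorem evaluates its sum over the grid to 1
([boxsum_cup]).  So it does not vanish on some unit cube, and on that cube none
of the labels is constant. *)

Set Implicit Arguments.
Unset Strict Implicit.
Unset Printing Implicit Defensive.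

Import Order.TTheory GRing.Theory Num.Theory.
Import numFieldNormedType.Exports metricType_numDomainType.

Local Open Scope classical_set_scope.
Local Open Scope ring_scope.

(** * Kuhn's lemma on labelled cubes *)

Section OrderedPairSums.
Variables (T : finType) (V : nmodType).
Implicit Types (D : {set T}) (F : T -> T -> V).

Lemma exchange_offdiag D F :
  \sum_(k in D) \sum_(l in D :\ k) F k l = \sum_(l in D) \sum_(k in D :\ l) F k l.
Proof.
rewrite (exchange_big_dep (mem D)) /=; last by move=> k l _ /setD1P[].
apply: eq_bigr => l lD; apply: eq_bigl => k.
by rewrite !inE lD andbT eq_sym andbC.
Qed.

(** The terms of indices (k, l) and (l, k) cancel in characteristic 2.  An
ordering of [T] selects one of the two. *)
Lemma sum_offdiag_sym D F : (forall x : V, x + x = 0) -> (forall k l, F k l = F l k) ->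
  \sum_(k in D) \sum_(l in D :\ k) F k l = 0.
Proof.
move=> add2 symF; pose lt (k l : T) := (enum_rank k < enum_rank l)%N.
have split_lt k : \sum_(l in D :\ k) F k l =
    \sum_(l in D :\ k | lt k l) F k l + \sum_(l in D :\ k | lt l k) F k l.
  rewrite (bigID (lt k)) /=; congr (_ + _); apply: eq_bigl => l.
  rewrite -leqNgt leq_eqVlt !inE; case: (eqVneq l k) => //= lk.
  rewrite (_ : (_ == _) = false) //; apply/negbTE; apply: contra lk => /eqP e.
  by apply/eqP/enum_rank_inj/val_inj.
under eq_bigr do rewrite split_lt.
rewrite big_split /=; set A := (X in X + _); set B := (X in _ + X).
suff -> : B = A by exact: add2.
rewrite /B /A (exchange_big_dep (mem D)) /=; last by move=> k l _ /andP[/setD1P[]].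
apply: eq_bigr => l lD; rewrite (eq_bigr (F l)) => [|k _]; last exact: symF.
by apply: eq_bigl => k; rewrite !inE lD !andbT eq_sym andbCA andbA.
Qed.

End OrderedPairSums.

Definition upd (T : eqType) (x : T -> nat) (k : T) (a : nat) : T -> nat :=
  fun l => if l == k then a else x l.

Definition step (T : eqType) (x : T -> nat) (k : T) : T -> nat := upd x k (x k).+1.

Lemma updC (T : eqType) (x : T -> nat) (k l : T) a b : k != l ->
  upd (upd x k a) l b = upd (upd x l b) k a.
Proof.
move=> kl; apply/funext => j; rewrite /upd; case: (eqVneq j l) => // ->.
by rewrite eq_sym (negbTE kl).
Qed.

Lemma stepC (T : eqType) (x : T -> nat) (k l : T) :
  step (step x k) l = step (step x l) k.
Proof.
have [->//|kl] := eqVneq k l.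
by rewrite /step /upd (negbTE kl) eq_sym (negbTE kl) -!/(upd _ _ _) updC.
Qed.

Section Cup.
Variables (T : finType) (R : comNzRingType) (add2 : forall x : R, x + x = 0).
Variable (g : T -> (T -> nat) -> R).
Implicit Types (x : T -> nat) (D : {set T}) (s : seq T).

(** The cup product of the coboundaries of the functions [g k], for [k] in [s],
on the cube with lowest corner [x] and set of directions [D].  Each term is an
edge path that leaves [x] and uses every direction at most once; it
contributes the product of the increments along its successive edges.
Increments are written as sums because signs do not matter in characteristic
2. *)
Fixpoint cup s D x : R :=
  if s is k :: s' then
    \sum_(l in D) (g k x + g k (step x l)) * cup s' (D :\ l) (step x l)
  else 1.

(** A cup product of coboundaries is a cocycle: the contributions of all the
facets of a cube cancel.  By induction on [s].  In the sum over ordered pairs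
(a, b) of directions, the values of [g k] at [x] and at the far corner of the
square spanned by [a] and [b] are symmetric in the pair, so one may replace the
other; the resulting increment of [g k] depends on [a] alone and factors out of
the cocycle relation for the tail of [s], taken at the corner [step x a]. *)
Lemma cup_closed s D x :
  \sum_(l in D) (cup s (D :\ l) x + cup s (D :\ l) (step x l)) = 0.
Proof.
elim: s D x => [|k s IH] D x /=; first by rewrite big1.
rewrite big_split /= exchange_offdiag.
pose H a b := cup s (D :\ a :\ b) (step (step x a) b).
have H_sym a b : H a b = H b a.
  by rewrite /H stepC finset.setDDl finset.setUC -finset.setDDl.
pose G a b := g k (step (step x a) b).
have -> : \sum_(a in D) \sum_(b in D :\ a) (g k (step x a) + G a b) * H a b =
          \sum_(a in D) \sum_(b in D :\ a) (g k x + g k (step x a)) * H a b.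
  apply/eqP; rewrite -subr_eq0 -sumrB; apply/eqP.
  have S0 := @sum_offdiag_sym _ _ D (fun a b => (G a b - g k x) * H a b) add2.
  rewrite -[RHS]S0 => [|a b]; last by rewrite H_sym /G stepC.
  apply: eq_bigr => a aD; rewrite -sumrB; apply: eq_bigr => b bD.
  by ring.
rewrite -big_split /= big1 // => a aD.
rewrite -big_split /=.
rewrite -[RHS](mulr0 (g k x + g k (step x a))) -[in RHS](IH (D :\ a) (step x a)).
rewrite mulr_sumr; apply: eq_bigr => b bD; rewrite mulrDr; congr (_ * _ + _).
by rewrite finset.setDDl finset.setUC -finset.setDDl.
Qed.

(** All the edge paths stay in the face where the coordinate [l] equals [c],
where [g l] has no increment. *)
Lemma cup_face s D x l (c : nat) : l \in s -> l \notin D -> x l = c ->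
  (forall y z : T -> nat, y l = c -> z l = c -> g l y = g l z) -> cup s D x = 0.
Proof.
move=> + + + gc; elim: s D x => //= k s IH D x.
rewrite inE => /orP[/eqP <-|ls] lD xl; apply: big1 => m mD;
  have ml : (step x m) l = c by rewrite /step /upd; case: eqVneq mD lD => // -> ->.
  by rewrite (gc _ (step x m)) // add2 mul0r.
by rewrite IH ?mulr0 // !inE negb_and lD orbT.
Qed.

Variable M : nat.

(** Iterating over a list of directions makes it easy to integrate one out. *)
Fixpoint boxsum s (F : (T -> nat) -> R) x : R :=
  if s is k :: s' then \sum_(a < M) boxsum s' F (upd x k a) else F x.

Lemma eq_boxsum s F F' x :
  (forall y, (forall l, l \notin s -> y l = x l) -> F y = F' y) ->
  boxsum s F x = boxsum s F' x.
Proof.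
elim: s x => [|k s IH] x FF' /=; first exact: FF'.
apply: eq_bigr => a _; apply: IH => y yx; apply: FF' => l.
by rewrite inE negb_or => /andP[lk ls]; rewrite yx // /upd (negbTE lk).
Qed.

Lemma boxsum_sum (I : finType) (P : pred I) s (F : I -> (T -> nat) -> R) x :
  boxsum s (fun y => \sum_(i | P i) F i y) x = \sum_(i | P i) boxsum s (F i) x.
Proof.
elim: s x => //= k s IH x.
by under eq_bigr do rewrite IH; rewrite exchange_big.
Qed.

Lemma boxsumD s F F' x : boxsum s (fun y => F y + F' y) x = boxsum s F x + boxsum s F' x.
Proof.
by elim: s x => //= k s IH x; under eq_bigr do rewrite IH; rewrite big_split.
Qed.

Lemma boxsum0 s x : boxsum s (fun=> 0) x = 0.
Proof. by elim: s x => //= k s IH x; rewrite big1. Qed.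

Lemma boxsum_step s F k x : k \notin s ->
  boxsum s (fun y => F (step y k)) x = boxsum s F (step x k).
Proof.
elim: s x => //= l s IH x; rewrite inE negb_or => /andP[kl ks].
apply: eq_bigr => a _; rewrite IH //; congr (boxsum _ _ _).
by rewrite /step /upd (negbTE kl) -!/(upd _ _ _) updC // eq_sym.
Qed.

(** Inner terms cancel in pairs along each grid line of direction [k]. *)
Lemma boxsum_telescope s F k x : uniq s -> k \in s ->
  boxsum s (fun y => F y + F (step y k)) x =
  boxsum (rem k s) F (upd x k 0%N) + boxsum (rem k s) F (upd x k M).
Proof.
elim: s x => //= l s IH x /andP[ls us]; rewrite inE.
have [-> _|kl /= ks] := eqVneq k l.
  move=> {IH}; rewrite /=.
  have E a : boxsum s (fun y => F y + F (step y l)) (upd x l a) =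
      boxsum s F (upd x l a) + boxsum s F (upd x l a.+1).
    rewrite boxsumD boxsum_step //; congr (_ + boxsum _ _ _); apply/funext => j.
    by rewrite /step /upd eqxx; case: eqP.
  under eq_bigr do rewrite E.
  elim: (M) => [|m IHm]; first by rewrite big_ord0 add2.
  by rewrite big_ord_recr /= IHm addrA -[X in X + _]addrA add2 addr0.
rewrite /= -big_split /=; apply: eq_bigr => a _.
by rewrite IH // !(updC _ _ _ (kl : k != l)).
Qed.

Hypothesis g0 : forall k x, x k = 0%N -> g k x = 0.
Hypothesis gM : forall k x, x k = M -> g k x = 1.

(** Stokes' theorem.  As the product over the tail [s] is a cocycle, the product
over [k :: s] is the coboundary of [F], the product of [g k] with the product
over [s], so its sum reduces to the faces of the grid.  The faces of a direction
[l] in [s] contribute nothing, because [g l] is constant there ([cup_face]).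
Of the two faces of direction [k], the lower one has [g k = 0] and the upper one
has [g k = 1]; the latter leaves the same sum in one dimension less. *)
Lemma boxsum_cup s x : uniq s -> boxsum s (cup s [set k in s]) x = 1.
Proof.
elim: s x => [//|k s IH] x; rewrite cons_uniq => /andP[ks us].
set D := [set _ in _].
pose F l y := g k y * cup s (D :\ l) y.
have Dk : D :\ k = [set l in s].
  apply/setP => l; rewrite !inE; case: eqVneq => //= ->.
  by rewrite (negbTE ks).
transitivity (boxsum (k :: s) (fun y => \sum_(l in D) (F l y + F l (step y l))) x).
  apply: eq_boxsum => y _ /=.
  have /(congr1 (fun c => g k y * c)) := cup_closed s D y.
  rewrite mulr0 mulr_sumr => closed.
  rewrite -[RHS]addr0 -[X in _ = _ + X]closed -big_split /=.
  apply: eq_bigr => l lD; rewrite /F; set u := cup _ _ (step _ _); set v := cup _ _ y.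
  by rewrite -[LHS]addr0 -(add2 (g k y * v)); ring.
rewrite boxsum_sum.
have usk : uniq (k :: s) by rewrite /= ks.
rewrite (eq_bigr (fun l => boxsum (rem l (k :: s)) (F l) (upd x l 0%N) +
   boxsum (rem l (k :: s)) (F l) (upd x l M))) => [|l]; last first.
  by rewrite inE => ls; exact: boxsum_telescope.
rewrite (bigD1 k) ?inE ?eqxx //= eqxx [X in _ + X]big1 ?addr0 => [|l].
  rewrite /F Dk (@eq_boxsum s _ (fun=> 0)) => [|y yx]; last first.
    by rewrite g0 ?mul0r // yx // /upd eqxx.
  rewrite boxsum0 add0r (@eq_boxsum s _ (cup s [set l in s])) => [|y yx]; last first.
    by rewrite gM ?mul1r // yx // /upd eqxx.
  by rewrite IH.
rewrite inE => /andP[+ lk]; rewrite inE (negbTE lk) /= => ls.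
have F0 c : (forall y z : T -> nat, y l = c -> z l = c -> g l y = g l z) ->
    boxsum (rem l (k :: s)) (F l) (upd x l c) = 0.
  move=> gc; rewrite (@eq_boxsum _ _ (fun=> 0)) ?boxsum0 // => y yx.
  rewrite /F (@cup_face s _ _ l c) ?mulr0 ?inE ?eqxx //.
  by rewrite yx ?mem_rem_uniqF // /upd eqxx.
rewrite -[if _ then _ else _]/(rem l (k :: s)).
rewrite (F0 0%N) => [|y z yl zl]; last by rewrite !g0.
by rewrite (F0 M) ?addr0 // => y z yl zl; rewrite !gM.
Qed.

End Cup.

Lemma sum_neq0 (V : nmodType) (I : finType) (P : pred I) (F : I -> V) :
  \sum_(i | P i) F i != 0 -> exists2 i, P i & F i != 0.
Proof.
move=> S0; suff /existsP[i /andP[Pi Fi]] : [exists i, P i && (F i != 0)] by exists i.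
apply: contraNT S0; rewrite negb_exists => /forallP F0; rewrite big1 // => i Pi.
by have := F0 i; rewrite Pi negbK => /eqP.
Qed.

Lemma boxsum_neq0 (T : finType) (R : comNzRingType) M (s : seq T)
    (F : (T -> nat) -> R) x :
  uniq s -> boxsum M s F x != 0 ->
  exists y, [/\ forall l, l \in s -> (y l < M)%N,
    forall l, l \notin s -> y l = x l & F y != 0].
Proof.
elim: s x => [|k s IH] x /=; first by exists x.
move=> /andP[ks us] /sum_neq0[a _] /IH[// | y [ys ynx Fy]]; exists y; split => //.
  move=> l; rewrite inE => /orP[/eqP ->|/ys //].
  by rewrite ynx // /upd eqxx.
by move=> l; rewrite inE negb_or => /andP[lk ls]; rewrite ynx // /upd (negbTE lk).
Qed.

Lemma cup_neq0 (T : finType) (R : comNzRingType) (g : T -> (T -> nat) -> R) s D x k :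
  cup g s D x != 0 -> k \in s ->
  exists a b : T -> nat,
  [/\ forall j, (x j <= a j <= x j + (j \in D))%N,
      forall j, (x j <= b j <= x j + (j \in D))%N & g k a + g k b != 0].
Proof.
elim: s D x => //= i s IH D x /sum_neq0[l lD].
have [->|gi] := eqVneq (g i x + g i (step x l)) 0; first by rewrite mul0r eqxx.
move=> cup_n0; rewrite inE => /orP[/eqP ->|ks].
  exists x, (step x l); split => // j; rewrite ?leqnn ?leq_addr //.
  by rewrite /step /upd; case: eqVneq => [->|]; rewrite ?lD; lia.
have [|a [b [xa xb gab]]] := IH (D :\ l) (step x l) _ ks.
  by apply: contraNneq cup_n0 => ->; rewrite mulr0.
exists a, b; split => // j; [have := xa j|have := xb j];
  rewrite /step /upd !inE; case: eqVneq => [->|]; rewrite ?lD; lia.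
Qed.

(** The total of the cup product over the grid is odd, so it is nonzero on some
unit cube; then each [g k] has a nonzero increment along an edge of that
cube. *)
Theorem kuhn_cube (T : finType) (M : nat) (g : T -> (T -> nat) -> bool) :
  (forall k x, x k = 0%N -> g k x = false) ->
  (forall k x, x k = M -> g k x = true) ->
  exists2 q : T -> nat, forall k, (q k < M)%N &
  forall k, exists a b : T -> nat,
  [/\ forall j, (q j <= a j <= (q j).+1)%N,
      forall j, (q j <= b j <= (q j).+1)%N & g k a != g k b].
Proof.
move=> g0 gM.
have add2 (b : bool) : b + b = 0 by exact: addbb.
have total := boxsum_cup add2 g0 gM (fun=> 0%N) (enum_uniq T).
have total_neq0 : boxsum M (enum T) (cup g (enum T) [set k in enum T]) (fun=> 0%N) != 0.
  by rewrite total.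
have [q [qM _ cup_n0]] := boxsum_neq0 (enum_uniq T) total_neq0.
exists q => k; first by apply: qM; rewrite mem_enum.
have [|a [b [qa qb gab]]] := cup_neq0 (k := k) cup_n0; first by rewrite mem_enum.
exists a, b; split => [j|j|].
- by have := qa j; case: (_ \in _); lia.
- by have := qb j; case: (_ \in _); lia.
by apply: contraNneq gab => ->; rewrite add2.
Qed.

(** * The Hex theorem in all dimensions *)

(** Moves of a chess king: all the coordinates may change by one at once. *)
Definition king (T : finType) (N : nat) (a b : {ffun T -> 'I_N.+1}) : bool :=
  [forall j, (a j <= (b j).+1) && (b j <= (a j).+1)]%N.

(** Let [W i] be the set of grid points of colour [i] linked to the face
[a i = 0] by points of colour [i], and suppose that no [W i] reaches the
opposite face.  In a grid three times finer, where the old point [w] becomes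
the centre [3 * w + 1] of a block, let [Z i] be the set of points at distance
at most 2 from the centres of [W i], enlarged by the face [y i = 0].  By Kuhn's
lemma, some unit cube meets both [Z i] and its complement, for every [i].  But
let [i] be the colour of the old point whose block contains the lowest corner of
that cube.  If this old point is in [W i], then the cube lies in [Z i].  If not,
then it is neither on the face [a i = 0] nor adjacent to [W i], and the
refinement leaves enough room for the cube to be disjoint from [Z i]. *)
Theorem hex (T : finType) (N : nat) (c : {ffun T -> 'I_N.+1} -> T) :
  exists i a p,
  [/\ path (@king T N) a p, all (fun b => c b == i) (a :: p),
      a i = 0%N :> nat & last a p i = N :> nat].
Proof.
pose e i (a b : {ffun T -> 'I_N.+1}) := (c b == i) && king a b.
pose W i := [set w : {ffun T -> 'I_N.+1} | [exists a : {ffun T -> 'I_N.+1},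
  [&& c a == i, a i == 0%N :> nat & connect (e i) a w]]].
have [[i [w]]|noW] := pselect (exists i w, w \in W i /\ w i = N :> nat).
  rewrite inE => -[/existsP[a /and3P[ca /eqP a0 /connectP[p ep ->]]] wN].
  exists i, a, p; split=> //.
    by apply: sub_path ep => u v /andP[].
  rewrite /= ca /=; elim: p a {ca a0 wN} ep => //= b p IH a /andP[/andP[-> _]].
  exact: IH.
have WN i (w : {ffun T -> 'I_N.+1}) : w \in W i -> (w i < N)%N.
  move=> wW; rewrite ltn_neqAle -ltnS ltn_ord andbT; apply/eqP => wN.
  by apply: noW; exists i, w.
(* Coordinatewise, |y - (3 * w + 1)| <= 2. *)
pose Z i (y : T -> nat) := (y i == 0%N) || [exists w : {ffun T -> 'I_N.+1}, (w \in W i) &&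
   [forall j, (y j <= 3 * w j + 3) && (3 * w j <= (y j).+1)]]%N.
(* On the face [y i = 3 * N + 1] no point is in [Z i], since w i < N on [W i]. *)
have [i y /= y0|i y /= yM|q qM qZ] := @kuhn_cube T (3 * N + 1)%N (fun i y => ~~ Z i y).
- by rewrite /Z y0.
- apply/negP => /orP[|/existsP[w /andP[/WN wN /forallP/(_ i)]]].
    by rewrite yM addn1.
  by rewrite yM; lia.
pose x : {ffun T -> 'I_N.+1} := [ffun j => inord (q j %/ 3)%N].
have xq j : (3 * x j <= q j < 3 * x j + 3)%N.
  by rewrite /x ffunE inordK; have := qM j; lia.
set i := c x; clearbody x.
have [a [b [qa qb]]] := qZ i.
suff Zx (y : T -> nat) : (forall j, (q j <= y j <= (q j).+1)%N) -> Z i y = (x \in W i).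
  by rewrite (Zx a) // (Zx b) // eqxx.
move=> qy; have [xW|xnW] := boolP (x \in W i).
  apply/orP; right; apply/existsP; exists x; rewrite xW; apply/forallP => j.
  by have := xq j; have := qy j; lia.
apply/negbTE; apply: contra xnW => /orP[yi0|/existsP[w /andP[wW /forallP wy]]].
  rewrite inE; apply/existsP; exists x; rewrite eqxx connect0 andbT /=.
  by have := xq i; have := qy i; lia.
move: wW; rewrite !inE => /existsP[a' /and3P[ca a0 aw]].
apply/existsP; exists a'; rewrite ca a0; apply: (connect_trans aw).
apply: connect1; rewrite /e eqxx; apply/forallP => j.
by have := xq j; have := qy j; have := wy j; lia.
Qed.

Lemma king_path_ivt (T : finType) N (i : T) (a : {ffun T -> 'I_N.+1}) p (j : nat) :
  path (@king T N) a p -> (a i <= j <= last a p i)%N ->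
  exists2 b, b \in a :: p & b i = j :> nat.
Proof.
elim: p a => [|b p IH] a /=.
  by move=> _ /anti_leq aj; exists a; rewrite ?inE.
move=> /andP[/forallP/(_ i) ab bp] /andP[aj jp].
have [bj|jb] := leqP (b i) j.
  have [|c cp cj] := IH b bp; first by rewrite bj.
  by exists c; rewrite // inE cp orbT.
by exists a; rewrite ?inE ?eqxx //; lia.
Qed.

(** * Connectedness by small steps, and limits of chains *)

(** Limits along one ultrafilter replace repeated extractions of convergent
subsequences. *)
Lemma ultra_limit (I : Type) (X : topologicalType) (U : set_system I) (s : I -> X) :
  UltraFilter U -> compact [set: X] -> exists x : X, s @ U --> x.
Proof.
move=> UU /(_ (s @ U) _ filterT)[x [_ clx]]; exists x => B xB.
have [//|UCB] := in_ultra_setVsetC (s @^-1` B) UU.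
by have [y []] := clx (~` B) B UCB xB.
Qed.

Section StepInduction.
Variables (R : realType) (X : metricType R).

(** A set that contains, with a point, every [d]-chain starting there.  Speaking
of such sets avoids handling the chains themselves. *)
Definition step_closed (d : R) (P : set X) := forall x y, mdist x y < d -> P x -> P y.

Lemma step_closed_open d P : 0 < d -> step_closed d P -> open P.
Proof.
move=> d0 stP; rewrite openE => x Px; rewrite /interior -filter_from_mdist_nbhs.
by exists d => // y xy; exact: stP Px.
Qed.

Lemma connected_step_ind d P : connected [set: X] -> 0 < d -> step_closed d P ->
  P !=set0 -> P = setT.
Proof.
move=> conX d0 stP P0; apply: conX => //; exists P; rewrite ?setTI //.
  exact: step_closed_open stP.
rewrite -openC; apply: (step_closed_open d0) => x y xy nPx Py.
by apply: nPx; apply: stP Py; rewrite metric_sym.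
Qed.

(** A Lebesgue number of the cover by a clopen set and its complement. *)
Lemma clopen_step_closed (P : set X) : compact [set: X] -> clopen P ->
  exists2 d, 0 < d & step_closed d P.
Proof.
move=> cX [oP cP].
have locP x : exists2 e, 0 < e & forall y, mdist x y < e -> P x <-> P y.
  have [Px|nPx] := pselect (P x).
    have : nbhs x P by exact: open_nbhs_nbhs.
    by rewrite -filter_from_mdist_nbhs => -[e e0 eP]; exists e => // y /eP.
  have : nbhs x (~` P) by apply: open_nbhs_nbhs; split => //; rewrite openC.
  by rewrite -filter_from_mdist_nbhs => -[e e0 eP]; exists e => // y /eP.
have : \forall d \near 0^'+,
    [set: X] `<=` (fun x => forall y, mdist x y < d -> P x -> P y).
  apply: ((compact_near_coveringP [set: X]).1 cX) => x _.
  have [e e0 eP] := locP x.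
  exists ([set y | mdist x y < e / 2], [set d | d < e / 2]); first split => /=.
  - by rewrite -filter_from_mdist_nbhs; exists (e / 2) => //=; lra.
  - by apply: nbhs_right_lt; lra.
  - move=> [y d] /= [xy de] z yz Py.
    have xz := metric_triangle x y z.
    by apply/(eP z); [lra|apply/(eP y); [lra|]].
move=> nearP; have [d [/= d0 dP]] := filter_ex (filterI (nbhs_right_gt 0) nearP).
by exists d => // x y; exact: dP.
Qed.

(** The converse of [connected_step_ind] for compact spaces: a clopen set is
step closed for some [d]. *)
Lemma step_ind_connected : compact [set: X] ->
  (forall d P, 0 < d -> step_closed d P -> P !=set0 -> P = setT) ->
  connected [set: X].
Proof.
move=> cX ind P P0 [C oC PC] [D cD PD].
have [|d d0 stP] := @clopen_step_closed P cX; last exact: ind d0 stP P0.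
by split; [rewrite PC setTI|rewrite PD setTI].
Qed.

End StepInduction.

Lemma path_iff (T : eqType) (e : rel T) (Q : T -> Prop) z p : path e z p ->
  {in z :: p &, forall a b, e a b -> (Q a <-> Q b)} ->
  {in z :: p, forall w, Q z <-> Q w}.
Proof.
elim: p z => [|b p IH] z /=; first by move=> _ _ w; rewrite inE => /eqP ->.
move=> /andP[zb bp] Qe w; rewrite inE => /orP[/eqP -> //|wp].
have Qzb : Q z <-> Q b by apply: Qe; rewrite ?inE ?eqxx ?orbT.
rewrite Qzb; apply: IH wp => // a c ap cp; apply: Qe; by rewrite inE ?ap ?cp orbT.
Qed.

(** A subset as a metric space in its own right; continua in the definition of
surjective semispan are types, not subsets. *)
Definition metric_sub (R : realType) (Z : metricType R) (L : set Z) : Type := {x | L x}.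

Section MetricSub.
Variables (R : realType) (Z : metricType R) (L : set Z).
Implicit Types x y : metric_sub L.

HB.instance Definition _ := gen_eqMixin (metric_sub L).
HB.instance Definition _ := gen_choiceMixin (metric_sub L).

Definition metric_sub_dist x y : R := mdist (sval x) (sval y).

Let dist_xx x : metric_sub_dist x x = 0. Proof. exact: mdistxx. Qed.

Let dist_pos x y : metric_sub_dist x y = 0 -> x = y.
Proof.
by move/mdist_positivity/eq_sig_hprop; apply => ? ? ?; exact: Prop_irrelevance.
Qed.

Let dist_sym x y : metric_sub_dist x y = metric_sub_dist y x.
Proof. exact: metric_sym. Qed.

Let dist_triangle y x z :
  metric_sub_dist x z <= metric_sub_dist x y + metric_sub_dist y z.
Proof. exact: metric_triangle. Qed.

HB.instance Definition _ := isMetric.Build R (metric_sub L)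
  dist_xx dist_pos dist_sym dist_triangle.

Lemma metric_subE x y : mdist x y = mdist (sval x) (sval y).
Proof. by []. Qed.

Lemma metric_sub_compact : compact [set: Z] ->
  (forall x : Z, (forall r, 0 < r -> exists2 y, L y & mdist x y < r) -> L x) ->
  compact [set: metric_sub L].
Proof.
move=> cZ clL; rewrite compact_ultra => F FU _.
have [x /cvgrPdist_lt Fx] := ultra_limit (@sval Z L) FU cZ.
have Lx : L x.
  apply: clL => r /Fx /filter_ex[y xy]; exists (sval y) => //; exact: svalP.
exists (exist _ x Lx); split => //; apply/fcvgrPdist_lt => e /Fx; exact.
Qed.

End MetricSub.

Lemma max_prod_compact (R : realType) n (Y : 'I_n -> metricType R) :
  (forall i, compact [set: Y i]) -> compact [set: max_prod Y].
Proof.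
move=> cY; rewrite compact_ultra => F FU _.
have lim i : exists x : Y i, (fun z : max_prod Y => z i) @ F --> x.
  exact: ultra_limit.
exists (fun i => projT1 (cid (lim i))); split => //.
apply/fcvgrPdist_lt => e e0.
have : \forall z \near F, forall i, mdist (projT1 (cid (lim i))) (z i) < e.
  apply: filter_forall => i; case: (cid (lim i)) => x /= Fx.
  exact: cvgr_dist_lt Fx e e0.
by apply: filterS => z zi; exact: max_prod_dist_lt.
Qed.

Section LimitOfChains.
Variables (R : realType) (Z : metricType R) (cZ : compact [set: Z]).
Variables (U : set_system nat) (UU : UltraFilter U) (Uoo : \oo `<=` U).
Variables (z : nat -> Z) (p : nat -> seq Z).
Hypothesis chain : forall k,
  path (fun a b => mdist a b < k.+1%:R^-1) (z k) (p k).

(** The limit along [U] of the point sets of the chains, in the sense of the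
Hausdorff distance. *)
Definition limit_set : set Z :=
  [set x | forall r, 0 < r ->
    \forall k \near U, exists2 w, w \in z k :: p k & mdist x w < r].

Lemma limit_set_cvg s x : (forall k, s k \in z k :: p k) -> s @ U --> x -> limit_set x.
Proof.
move=> sS /cvgrPdist_lt sx r /sx; apply: filterS => k xk; by exists (s k).
Qed.

(** If, on the contrary, the chains had points far from the limit set for a
large set of indices, then a limit of these points would be a member of the
limit set close to some of them. *)
Lemma near_limit_set r : 0 < r ->
  \forall k \near U, forall w, w \in z k :: p k -> exists2 x, limit_set x & mdist x w < r.
Proof.
move=> r0; pose bad k w := w \in z k :: p k /\ forall x, limit_set x -> ~ mdist x w < r.
have [|Ubad] := in_ultra_setVsetC (~` [set k | exists w, bad k w]) UU.
  apply: filterS => k /= nbad w wS; apply: contrapT => nx; apply: nbad.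
  by exists w; split => // x Lx xw; apply: nx; exists x.
rewrite setCK in Ubad.
pose s k := if pselect (exists w, bad k w) is left h then projT1 (cid h) else z k.
have sS k : s k \in z k :: p k.
  by rewrite /s; case: pselect => [h|_]; [case: cid => w []|rewrite inE eqxx].
have [x sx] := ultra_limit s UU cZ.
have [k [/= badk xk]] := filter_ex (filterI Ubad (cvgr_dist_lt sx r0)).
move: xk; rewrite /= /s; case: pselect => // h; case: cid => w /= [_ wL].
by move/(wL x) => []; exact: limit_set_cvg sx.
Qed.

(** For connectedness, let [P] be closed under steps shorter than [d] and
consider a chain with steps shorter than [d / 3], lying within [d / 3] of the
limit set and passing within [d / 3] of two given points [x] and [y] of it.
Being [d / 3]-close to a point of [P] is then inherited by each neighbour in the
chain, so membership in [P] passes from [x] to [y]. *)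
Lemma limit_set_continuum : continuum (metric_sub limit_set).
Proof.
have cK : compact [set: metric_sub limit_set].
  apply: metric_sub_compact => // x xL r r0.
  have [|y Ly xy] := xL (r / 2); first by lra.
  have : 0 < r / 2 by lra.
  move=> /Ly; apply: filterS => k [w wS yw]; exists w => //.
  by have := metric_triangle x y w; lra.
split => //.
  have [x zx] := ultra_limit z UU cZ.
  have Lx : limit_set x by apply: limit_set_cvg zx => k; rewrite inE eqxx.
  by exists (exist _ x Lx).
apply: step_ind_connected => // d P d0 stP [x Px]; apply/seteqP; split=> // y _.
have d30 : 0 < d / 3 by lra.
near U => k.
pose Q w := exists2 t : metric_sub limit_set, P t & mdist (sval t) w < d / 3.
have Qstep a b : b \in z k :: p k -> mdist a b < d / 3 -> Q a -> Q b.
  move=> bS ab [t Pt ta].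
  have [|t' Lt' tb] := near (near_limit_set d30) k _ b bS; first by [].
  exists (exist _ t' Lt') => //=; apply: stP Pt; rewrite metric_subE /=.
  have := metric_triangle (sval t) a t'; have := metric_triangle a b t'.
  by rewrite (metric_sym b); lra.
have kd : k.+1%:R^-1 < d / 3.
  near: k; apply: Uoo; exact: near_infty_natSinv_lt (PosNum d30).
have Qiff : {in z k :: p k, forall w, Q (z k) <-> Q w}.
  apply: (path_iff (chain k)) => a b aS bS ab; split; apply: Qstep => //.
    exact: lt_trans ab kd.
  by rewrite metric_sym; exact: lt_trans ab kd.
have [w wS xw] : exists2 w, w \in z k :: p k & mdist (sval x) w < d / 3.
  by near: k; apply: (svalP x).
have [v vS yv] : exists2 w, w \in z k :: p k & mdist (sval y) w < d / 3.
  by near: k; apply: (svalP y).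
have : Q v by apply/(Qiff v vS)/(Qiff w wS); exists x.
move=> [t Pt tv]; apply: stP Pt; rewrite metric_subE.
have := metric_triangle (sval t) v (sval y); rewrite (metric_sym v); lra.
Unshelve. all: by end_near. Qed.

End LimitOfChains.

(** * Chains in continua of surjective semispan zero *)

Notation square Y := (max_prod (fun _ : 'I_2 => Y)).

Section SemispanChains.
Variables (R : realType) (Y : metricType R).

Definition max_pair (u v : Y) : square Y := fun i => if i == ord0 then u else v.

Lemma proj_continuous_sub (L : set (square Y)) (i : 'I_2) :
  continuous (fun x : metric_sub L => sval x i).
Proof.
move=> x A Ax; change (nbhs x ((fun x : metric_sub L => sval x i) @^-1` A)).
move: Ax; rewrite -(filter_from_mdist_nbhs (sval x i)) => -[e e0 eA].
rewrite -(filter_from_mdist_nbhs x); exists e => // y xy; apply: eA.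
by apply: le_lt_trans xy; exact: max_prod_dist_ge.
Qed.

Lemma square_dist_ge (x w : square Y) i : @mdist R Y (x i) (w i) <= mdist x w.
Proof. exact: max_prod_dist_ge. Qed.

(** A quantitative form of surjective semispan 0, with finite chains in the
square in place of continua.  Counterexamples with steps tending to 0 have a
limit continuum, and the two projections of this continuum to [Y], the first of
which is surjective by density, have no coincidence. *)
Lemma semispan0_chain (eps : R) : continuum Y -> surjective_semispan0 Y -> 0 < eps ->
  exists2 d, 0 < d & forall (z : square Y) p,
    path (fun a b => mdist a b < d) z p ->
    (forall y, exists2 w, w \in z :: p & @mdist R Y y (w ord0) < d) ->
    exists2 w, w \in z :: p & @mdist R Y (w ord0) (w ord_max) <= eps.
Proof.
move=> [Y0 cY conY] spanY eps0; apply: contrapT => nd.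
have bad k : exists zp : square Y * seq (square Y),
    [/\ path (fun a b => mdist a b < k.+1%:R^-1) zp.1 zp.2,
      forall y, exists2 w, w \in zp.1 :: zp.2 & @mdist R Y y (w ord0) < k.+1%:R^-1 &
      forall w, w \in zp.1 :: zp.2 -> eps < @mdist R Y (w ord0) (w ord_max)].
  apply: contrapT => nzp; apply: nd; exists (k.+1%:R^-1); first by rewrite invr_gt0.
  move=> z p zp dense; apply: contrapT => nw; apply: nzp.
  exists (z, p); split => //= w wS.
  by rewrite ltNge; apply/negP => wle; apply: nw; exists w.
pose z k := (projT1 (cid (bad k))).1; pose p k := (projT1 (cid (bad k))).2.
have chain k : path (fun a b => mdist a b < k.+1%:R^-1) (z k) (p k).
  by rewrite /z /p; case: cid => ? [].
have dense k y : exists2 w, w \in z k :: p k & @mdist R Y y (w ord0) < k.+1%:R^-1.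
  by rewrite /z /p; case: cid => ? [].
have far k w : w \in z k :: p k -> eps < @mdist R Y (w ord0) (w ord_max).
  by move: w; rewrite /z /p; case: cid => ? [].
have [U [UU Uoo]] := ultraFilterLemma (@eventually_filter).
have cZ : compact [set: square Y] by exact: max_prod_compact.
pose L := limit_set U z p.
have [y _|[x Lx] /= x01] := spanY _ (limit_set_continuum cZ UU Uoo chain)
   _ _ (@proj_continuous_sub _ ord0) (@proj_continuous_sub _ ord_max).
  pose s k := projT1 (cid2 (dense k y)).
  have sS k : s k \in z k :: p k by rewrite /s; case: cid2.
  have [x sx] := ultra_limit s UU cZ.
  exists (exist _ x (limit_set_cvg UU sS sx)) => //=.
  apply: mdist_positivity; apply/eqP; rewrite eq_le mdist_ge0 andbT.
  apply/ler_addgt0Pl => e e0; rewrite addr0.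
  have e20 : 0 < e / 2 by lra.
  have [k [/= xs ke]] := filter_ex (filterI (cvgr_dist_lt sx e20)
    (Uoo _ (near_infty_natSinv_lt (PosNum e20)))).
  have ys : @mdist R Y y (s k ord0) < e / 2.
    by apply: lt_trans ke; rewrite /s; case: cid2.
  have := square_dist_ge x (s k) ord0.
  have := @metric_triangle R Y (x ord0) (s k ord0) y.
  by rewrite (metric_sym (s k ord0) y); lra.
have e20 : 0 < eps / 2 by lra.
have [k [w wS xw]] := filter_ex (Lx _ e20).
have := far k w wS; rewrite ltNge => /negP; apply.
have := square_dist_ge x w ord_max; rewrite -x01.
have := square_dist_ge x w ord0; rewrite (metric_sym (x ord0)).
by have := @metric_triangle R Y (w ord0) (x ord0) (w ord_max); lra.
Qed.

Lemma joining_chain (eta : R) : continuum Y -> 0 < eta ->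
  forall (s : seq Y) x, exists2 p, path (fun a b => mdist a b < eta) x p &
    {subset s <= x :: p}.
Proof.
move=> [_ cY conY] eta0; set e := fun a b : Y => _.
have join x y : exists2 p, path e x p & last x p = y.
  pose P := [set y | exists2 p, path e x p & last x p = y].
  suff PT : P = setT by have : P y by rewrite PT.
  apply: (connected_step_ind conY eta0) => [a b ab [p xp pa]|]; last by exists x, [::].
  by exists (rcons p b); rewrite ?last_rcons // rcons_path xp pa.
elim=> [|y s IH] x; first by exists [::].
have [q xq qy] := join x y; have [p yp sp] := IH y.
exists (q ++ p); first by rewrite cat_path xq qy.
move=> w; rewrite inE -cat_cons mem_cat => /orP[/eqP ->|/sp].
  by rewrite -qy mem_last.
by rewrite inE => /orP[/eqP ->|->]; rewrite ?orbT // -qy mem_last.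
Qed.

(** Otherwise the sets of points far from a finite set [s] generate a proper
filter as [s] varies.  A cluster point [x] of it is not far from [[:: x]]. *)
Lemma finite_net (d : R) : compact [set: Y] -> 0 < d ->
  exists s : seq Y, forall y, exists2 c, c \in s & mdist c y < d.
Proof.
move=> cY d0; apply: contrapT => nonet.
pose far (s : seq Y) := [set y | forall c, c \in s -> ~ mdist c y < d].
have farF : ProperFilter (filter_from setT far).
  apply: filter_from_proper.
    apply: filter_from_filter => [|s t _ _]; first by exists [::].
    by exists (s ++ t) => // y yst; split => c cs; apply: yst; rewrite mem_cat cs ?orbT.
  move=> s _; apply: contrapT => nfar; apply: nonet; exists s => y.
  apply: contrapT => nc; apply: nfar; exists y => c cs cy; apply: nc.
  by exists c.
have [|x [_ clx]] := cY _ farF; first exact: filterT.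
have [||y []] := clx (far [:: x]) (ball x d); first by exists [:: x].
  exact: nbhsx_ballx.
by move=> /(_ x (mem_head _ _)); rewrite ballEmdist.
Qed.

(** The walk visits a finite net.  It is extended by its last point after the
index [N], so that walks in different factors can be given the same length. *)
Lemma dense_walk (eta : R) : continuum Y -> 0 < eta ->
  exists (phi : nat -> Y) (N : nat), (forall j, mdist (phi j) (phi j.+1) < eta) /\
    forall y, exists2 j, (j <= N)%N & mdist y (phi j) < eta.
Proof.
move=> contY eta0; have [[x _] cY conY] := contY.
have [s net] := finite_net cY eta0.
have [p xp sp] := joining_chain contY eta0 s x.
exists (nth (last x p) (x :: p)), (size p); split => [j|y].
  have [jp|pj] := ltnP j (size p); first exact: (pathP _ xp).
  rewrite [nth _ _ j.+1]nth_default // (_ : nth _ _ j = last x p) ?mdistxx //.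
  move: pj; rewrite leq_eqVlt => /orP[/eqP <-|pj]; last by rewrite nth_default.
  by rewrite nth_last.
have [c /sp cp cy] := net y.
exists (index c (x :: p)).
  by rewrite -ltnS (_ : (size p).+1 = size (x :: p)) ?index_mem.
by rewrite nth_index // metric_sym.
Qed.

End SemispanChains.

(** * The proximate fixed point property of products *)

Theorem theorem3 (R : realType) (n : nat) (hn : (1 <= n)%N)
    (Y : 'I_n -> metricType R)
    (contY : forall i : 'I_n, continuum (Y i))
    (spanY : forall i : 'I_n, surjective_semispan0 (Y i)) :
  proximate_fixed_point_property (max_prod Y).
Proof.
move=> eps eps0.
pose D i := cid2 (semispan0_chain (contY i) (spanY i) eps0).
pose d : R := \big[Num.min/1]_i s2val (D i).
have d0 : 0 < d by apply: lt_bigmin => // i _; exact: (s2valP (D i)).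
have dD i : d <= s2val (D i) by exact: bigmin_le_cond.
exists d => // f [eta eta0 feta]; apply: contrapT => nofix.
(* Steps below [eta] keep the images [d]-close, and steps below [d] make the
   first entries of the pairs [d]-close. *)
pose e := Num.min eta d.
have e0 : 0 < e by rewrite lt_min eta0.
pose walk i := cid (dense_walk (contY i) e0).
pose phi i := projT1 (walk i).
pose len i := projT1 (cid (projT2 (walk i))).
have phi_step i j : mdist (phi i j) (phi i j.+1) < e.
  by have [+ _] := projT2 (cid (projT2 (walk i))); apply.
have phi_dense i y : exists2 j, (j <= len i)%N & mdist y (phi i j) < e.
  by have [_] := projT2 (cid (projT2 (walk i))); apply.
pose N := \max_i len i.
pose pt (a : {ffun 'I_n -> 'I_N.+1}) : max_prod Y := fun i => phi i (a i).
have pt_king a b : king a b -> mdist (pt a) (pt b) < e.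
  move=> /forallP ab; apply: max_prod_dist_lt => // i; rewrite /pt.
  have /andP[] := ab i; rewrite leq_eqVlt ltnS => /orP[/eqP ->|ba].
    by rewrite metric_sym.
  rewrite leq_eqVlt ltnS => /orP[/eqP -> //|ab'].
  by rewrite (_ : val (a i) = b i) ?mdistxx //; apply/anti_leq/andP.
have moved a : exists i, eps < mdist (pt a i) (f (pt a) i).
  apply: contrapT => nmoved; apply: nofix; exists (pt a).
  apply: max_prod_dist_le => [|i]; first exact: ltW.
  by rewrite leNgt; apply/negP => ?; apply: nmoved; exists i.
pose c a := projT1 (cid (moved a)).
have cP a : eps < mdist (pt a (c a)) (f (pt a) (c a)).
  by rewrite /c; case: cid.
have [i [a [p [ap /allP cp a0 pN]]]] := hex c.
pose h b := max_pair (pt b i) (f (pt b) i).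
(* The path crosses the grid in the direction [i], so the first entries of the
   pairs [h b] exhaust the walk [phi i]. *)
have [||w] := s2valP' (D i) (h a) [seq h b | b <- p].
- rewrite path_map; apply: sub_path ap => u v /pt_king uv /=.
  apply: lt_le_trans (dD i); apply: max_prod_dist_lt => // j.
  have uvd : mdist (pt u) (pt v) < d by apply: lt_le_trans uv _; rewrite ge_min lexx orbT.
  rewrite /h /max_pair; case: ifP => _.
    exact: le_lt_trans (max_prod_dist_ge _ _ i) uvd.
  apply: le_lt_trans (max_prod_dist_ge _ _ i) _; apply: feta.
  by apply: lt_le_trans uv _; rewrite ge_min lexx.
- move=> y; have [j jN yj] := phi_dense i y.
  have [|b bp bj] := @king_path_ivt _ _ i a p j ap.
    by rewrite a0 pN (leq_trans jN) // leq_bigmax.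
  exists (h b); first by rewrite -map_cons map_f.
  rewrite /h /max_pair /pt /= bj; apply: lt_le_trans yj _.
  by apply: le_trans (dD i); rewrite ge_min lexx orbT.
rewrite -map_cons => /mapP[b bp ->].
have /eqP cb := cp b bp; have := cP b; rewrite cb.
by rewrite /h /max_pair /= leNgt => ->.
Qed.
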